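(* Let $N$ be an even positive integer and suppose $m$ is a positive integer such that $m>N-1$. Then there is a unique integer $q$ such that $-2N+2<m-q(N-1)<2N-2$ and $m+q\equiv 2\pmod 4$. Let $g(q)=(m+q)^2N-q^2N^2-mN^2$. Then for every supersaturated design with $m$ factors and $N$ runs the following hold. 1. If $N\equiv 0\pmod 4$, then $$E(s^2)\ge\begin{cases}\dfrac{g(q)+2N^2-4N}{m(m-1)}, & \text{when } |m-q(N-1)|<N-1,\\[2mm] \dfrac{g(q)-2N^2+4N+4N|m-q(N-1)|}{m(m-1)}, & \text{when } N-1<|m-q(N-1)|\le\frac32N-2,\\[2mm] \dfrac{g(q)+4N^2-4N}{m(m-1)}, & \text{when } |m-q(N-1)|>\frac32N-2.\end{cases}$$ 2. If $N\equiv 2\pmod 4$ and $q$ is even, then $E(s^2)\ge\max(h(q),4)$, where $$h(q)=\begin{cases}\dfrac{g(q)+2N^2-4N+8}{m(m-1)}, & \text{when } |m-q(N-1)|<N-1,\\[2mm] \dfrac{g(q)-2N^2+20N+(4N-8)|m-q(N-1)|-24}{m(m-1)}, & \text{when } N-1<|m-q(N-1)|\le\frac32N-3,\\[2mm] \dfrac{g(q)+4N^2-4N}{m(m-1)}, & \text{when } |m-q(N-1)|>\frac32N-3.\end{cases}$$ 3. If $N\equiv 2\pmod 4$ and $q$ is odd, then $E(s^2)\ge\max(h(q),4)$, where $$h(q)=\begin{cases}\dfrac{g(q)+2N^2-4N}{m(m-1)}, & \text{when } |m-q(N-1)|<N-1,\\[2mm] \dfrac{g(q)-2N^2+4N+4N|m-q(N-1)|}{m(m-1)},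 & \text{when } N-1<|m-q(N-1)|\le\frac32N-1,\\[2mm] \dfrac{g(q)+4N^2-12N+8|m-q(N-1)|+8}{m(m-1)}, & \text{when } |m-q(N-1)|>\frac32N-1.\end{cases}$$
   Context: A supersaturated design with $m$ factors (each at two levels) and $N$ runs is an $N\times m$ matrix $\mathbf{X}$ with entries $1$ and $-1$, where $N$ is even and $m>N-1$, such that each column contains the same number of $1$'s and $-1$'s, and no two distinct columns $\mathbf{x},\mathbf{y}$ are completely aliased, i.e. neither $\mathbf{x}=\mathbf{y}$ nor $\mathbf{x}=-\mathbf{y}$ (consequently $m\le\binom{N-1}{N/2-1}$). For such a design, $E(s^2)=\sum_{1\le i<j\le m}s_{ij}^2\big/\binom{m}{2}$, where $s_{ij}$ is the $(i,j)$th entry of $\mathbf{X}^T\mathbf{X}$.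
   Formalization: The upper inequality is taken non-strict, m-q(N-1) ≤ 2N-2, because with both strict no q exists when m=k(N-1) and 4 divides kN (e.g. N=8, m=14); in all other cases the same q is selected. *)

(* Defs.v *)
From mathcomp Require Import all_boot all_order all_algebra.

Set Implicit Arguments.
Unset Strict Implicit.
Unset Printing Implicit Defensive.

Import Order.TTheory GRing.Theory Num.Theory.

Local Open Scope ring_scope.

Definition supersaturated_design (N m : nat) (X : 'M[int]_(N, m)) : Prop :=
  [/\ ~~ odd N,
      (N - 1 < m)%N,
      forall (r : 'I_N) (j : 'I_m), X r j = 1 \/ X r j = -1,
      forall j : 'I_m, #|[set r | X r j == 1]| = #|[set r | X r j == -1]|
    & forall j k : 'I_m, j != k ->
        col j X <> col k X /\ col j X <> - col k X].

Definition Es2 (N m : nat) (X : 'M[int]_(N, m)) : rat :=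
  (\sum_(i < m) \sum_(j < m | (i < j)%N) ((X^T *m X) i j ^+ 2)%:~R)
    / 'C(m, 2)%:R.

(* The upper endpoint 2N - 2 is allowed.  With both inequalities strict, no q
   exists when m = k(N - 1) and 4 divides kN (for instance N = 8, m = 14): the
   residue condition then forces q = k - 2 or q = k + 2, where m - q(N - 1) is
   2N - 2 or -2N + 2.  For all other m the upper endpoint is not attained under
   the congruence, so that both versions select the same q. *)
Definition admissible (N m : nat) (q : int) : Prop :=
  [/\ - (2 * N%:Z) + 2 < m%:Z - q * (N%:Z - 1),
      m%:Z - q * (N%:Z - 1) <= 2 * N%:Z - 2
    & (m%:Z + q = 2 %[mod 4])%Z].

Definition g (N m : nat) (q : int) : rat :=
  (m%:R + q%:~R) ^+ 2 * N%:R - q%:~R ^+ 2 * N%:R ^+ 2 - m%:R * N%:R ^+ 2.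

Definition dev (N m : nat) (q : int) : rat :=
  `|m%:R - q%:~R * (N%:R - 1)|.

(* In the three functions below the value at dev N m q = N - 1 is irrelevant:
   it would give m + q = kN + 1 or kN - 1 for some integer k, contradicting
   m + q = 2 mod 4 since N is even. *)

Definition bound_0mod4 (N m : nat) (q : int) : rat :=
  let n : rat := N%:R in
  let d := dev N m q in
  (if d < n - 1 then g N m q + 2 * n ^+ 2 - 4 * n
   else if d <= 3 / 2 * n - 2 then
     g N m q - 2 * n ^+ 2 + 4 * n + 4 * n * d
   else g N m q + 4 * n ^+ 2 - 4 * n)
  / (m%:R * (m%:R - 1)).

Definition h_even (N m : nat) (q : int) : rat :=
  let n : rat := N%:R in
  let d := dev N m q in
  (if d < n - 1 then g N m q + 2 * n ^+ 2 - 4 * n + 8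
   else if d <= 3 / 2 * n - 3 then
     g N m q - 2 * n ^+ 2 + 20 * n + (4 * n - 8) * d - 24
   else g N m q + 4 * n ^+ 2 - 4 * n)
  / (m%:R * (m%:R - 1)).

Definition h_odd (N m : nat) (q : int) : rat :=
  let n : rat := N%:R in
  let d := dev N m q in
  (if d < n - 1 then g N m q + 2 * n ^+ 2 - 4 * n
   else if d <= 3 / 2 * n - 1 then
     g N m q - 2 * n ^+ 2 + 4 * n + 4 * n * d
   else g N m q + 4 * n ^+ 2 - 12 * n + 8 * d + 8)
  / (m%:R * (m%:R - 1)).

(* Main.v *)
Require Import Defs.
From mathcomp Require Import all_boot all_order all_algebra.
From mathcomp Require Import zify ring lra.

Import Order.TTheory GRing.Theory Num.Theory.
Local Open Scope ring_scope.

(** Since [X^T X] and [X X^T] have the same sum of squared entries, the bound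
    can be proved on the rows.  Balanced columns make every row of [X X^T] sum
    to 0, so with [c u v := (X X^T) u v + q] the off-diagonal entries of [c] in
    each row sum to [- D], where [D = m - q (N - 1)], and expanding the squares
    gives [\sum_(i != j) s_ij ^ 2 = g(q) + \sum_(u != v) c_uv ^ 2]
    ([sum_sqr_columns]).  It remains to minimize the last sum.

    The congruence [m + q = 2 mod 4] controls [c] modulo 4.  For three rows of
    signs the sum of the three pairwise inner products is [- m] modulo 4, hence
    the rows fall into two classes (rows with equal parity of the number of
    entries [-1]) such that [c_uv = 2 mod 4] inside a class and
    [c_uv = 0 mod 4] across.  Let [p <= N / 2] be the size of one class [A].

    - Each entry inside a class has square at least 4.  As the number of such
      entries is least for [p = N / 2], this settles small [|D|].
    - For large [|D|] the row sums matter.  They enter through chords of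
      the square function: with [e] a sign, [c^2 >= 8 e c - 12] inside [A],
      [c^2 >= 4 e c] across, and [c^2 >= 4] inside the complement of [A].
      Both orders of the pairs across together with the pairs inside [A] then
      produce exactly the row sums of the rows in [A] ([sum_sqr_ge_chord]).
      The resulting bound is a concave function of [p], so it is at least its
      smaller value at the two ends of the range of [p]
      ([chord_bound_ge_end]).

    The row sums also determine the parity of [p] ([exists_class_size]): for
    [N = 2 mod 4], where [N / 2] is odd, [p] has the parity of [q].  So the
    range of [p] is [[0, N / 2]] for [N = 0 mod 4], [[0, N / 2 - 1]] for [q]
    even, and [[1, N / 2]] for [q] odd; the values at the ends of these ranges
    are the formulas of the theorem, and the threshold for [|D|] is where the
    two end values agree.  Finally, for [N = 2 mod 4] two balanced columns have
    inner product 2 modulo 4, which gives the bound 4. *)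

(** * Squares of integers in a class modulo 4 *)

Lemma sqr_ge4 {c : int} : (c = 2 %[mod 4])%Z -> 4 <= c ^+ 2.
Proof.
move=> c2; have [|] : c <= -2 \/ 2 <= c by lia.
  by move=> ?; nra.
by move=> ?; nra.
Qed.

(** The chord of the square function through 2 and 6, consecutive members of
    the class of 2. *)
Lemma sqr_ge_chord26 {c : int} : (c = 2 %[mod 4])%Z -> 8 * c - 12 <= c ^+ 2.
Proof.
move=> c2; have [|] : c <= 2 \/ 6 <= c by lia.
  by move=> ?; nra.
by move=> ?; nra.
Qed.

(** The chord through 0 and 4; its slope is half that of the chord through 2
    and 6, because an entry across the classes is counted in one row of the
    chosen class and an entry inside in two. *)
Lemma sqr_ge_chord04 {c : int} : (c = 0 %[mod 4])%Z -> 4 * c <= c ^+ 2.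
Proof.
move=> c0; have [|] : c <= 0 \/ 4 <= c by lia.
  by move=> ?; nra.
by move=> ?; nra.
Qed.

(** * Sums over distinct pairs *)

Lemma sum_neq {R : zmodType} {I : finType} (u : I) (F : I -> R) :
  \sum_(v | u != v) F v = \sum_v F v - F u.
Proof.
rewrite [\sum_v F v](bigD1 u) //= addrAC subrr add0r.
by apply: eq_bigl => v; rewrite eq_sym.
Qed.

Lemma sum_neq_sym {R : nmodType} {m : nat} (F : 'I_m -> 'I_m -> R) :
    (forall i j, F i j = F j i) ->
  \sum_i \sum_(j | i != j) F i j
    = (\sum_(i < m) \sum_(j < m | (i < j)%N) F i j) *+ 2.
Proof.
move=> F_sym; rewrite mulr2n.
rewrite [in X in _ = _ + X](exchange_big_dep predT) //= -big_split /=.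
apply: eq_bigr => i _; rewrite (bigID (fun j : 'I_m => (i < j)%N)) /=.
congr (_ + _); first by apply: eq_bigl => j; rewrite -(inj_eq val_inj) /=; lia.
by apply: eq_big => [j|j _]; [rewrite -(inj_eq val_inj) /=; lia | rewrite F_sym].
Qed.

Lemma sum_mem {I : finType} (A : {set I}) :
  \sum_u (u \in A)%:R = #|A|%:R :> int.
Proof.
rewrite -sum1_card natr_sum [RHS]big_mkcond /=.
by apply: eq_bigr => u _; case: (u \in A).
Qed.

Lemma sum_mem_pairs {I : finType} (A : {set I}) :
  \sum_u \sum_(v | u != v) (u \in A)%:R * (v \in A)%:R
    = #|A|%:R ^+ 2 - #|A|%:R :> int.
Proof.
under eq_bigr => u _ do rewrite sum_neq -mulr_sumr sum_mem -natrM mulnb andbb.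
by rewrite sumrB -mulr_suml !sum_mem expr2.
Qed.

Lemma card_setCz {I : finType} (A : {set I}) :
  #|~: A|%:R = #|I|%:R - #|A|%:R :> int.
Proof. by rewrite -(cardsC A) natrD addrAC subrr add0r. Qed.

(** * Symmetric arrays with two classes modulo 4 *)

(** Four times the number of ordered pairs of distinct elements inside one of
    two complementary classes of sizes [p] and [n - p]. *)
Definition within_bound {R : comNzRingType} (n p : R) : R :=
  4 * (p ^+ 2 - p) + 4 * ((n - p) ^+ 2 - (n - p)).

(** Sum of the chord bounds when every row sum has absolute value [d]: each of
    the [p] rows of the chosen class contributes [8 d], each ordered pair inside
    this class [- 12], and each ordered pair inside the other class [4]. *)
Definition chord_bound {R : comNzRingType} (n d p : R) : R :=
  8 * p * d - 12 * (p ^+ 2 - p) + 4 * ((n - p) ^+ 2 - (n - p)).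

Section TwoClasses.
Variables (I : finType) (c : I -> I -> int) (A : {set I}) (S : int).
Hypothesis c_sym : forall u v, c u v = c v u.
Hypothesis c_same : forall u v, (u \in A) = (v \in A) -> (c u v = 2 %[mod 4])%Z.
Hypothesis c_diff : forall u v, (u \in A) != (v \in A) -> (c u v = 0 %[mod 4])%Z.
Hypothesis c_row : forall u, \sum_(v | u != v) c u v = S.

Lemma sum_sqr_ge_within :
  within_bound #|I|%:R #|A|%:R <= \sum_u \sum_(v | u != v) c u v ^+ 2.
Proof.
rewrite /within_bound -card_setCz -!sum_mem_pairs !mulr_sumr -big_split /=.
apply: ler_sum => u _; rewrite !mulr_sumr -big_split /=.
apply: ler_sum => v _; rewrite !inE.
have := @c_same u v; case: (u \in A); case: (v \in A) => /= H;
  rewrite ?(mulr0, mul0r, mulr1, addr0, add0r) ?sqr_ge0 //; exact/sqr_ge4/H.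
Qed.

(** Pointwise, [4 (1_A u + 1_A v) c u v] is the linear part of all three chords
    at once; summed over the pairs it only involves row sums. *)
Lemma sum_sqr_ge_chord_signed :
  chord_bound #|I|%:R S #|A|%:R <= \sum_u \sum_(v | u != v) c u v ^+ 2.
Proof.
set p := #|A|%:R.
have row_part : \sum_u \sum_(v | u != v) (u \in A)%:R * c u v = p * S.
  rewrite /p -sum_mem mulr_suml.
  by apply: eq_bigr => u _; rewrite -mulr_sumr c_row.
have col_part : \sum_u \sum_(v | u != v) (v \in A)%:R * c u v = p * S.
  rewrite -row_part (exchange_big_dep predT) //=; apply: eq_bigr => v _.
  by apply: eq_big => [u|u _]; [rewrite eq_sym | rewrite c_sym].
rewrite /chord_bound.
have -> : 8 * p * S = 4 * (p * S) + 4 * (p * S) by ring.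
rewrite -{1}row_part -col_part -card_setCz -!sum_mem_pairs -mulNr.
rewrite !mulr_sumr -!big_split /=.
apply: ler_sum => u _; rewrite !mulr_sumr -!big_split /=.
apply: ler_sum => v _; rewrite !inE.
have := @c_same u v; have := @c_diff u v.
case: (u \in A); case: (v \in A) => /= Hd Hs;
  rewrite ?(mulr0, mul0r, mulr1, mul1r, addr0, add0r).
- by have := sqr_ge_chord26 (Hs erefl); lra.
- exact: sqr_ge_chord04 (Hd erefl).
- exact: sqr_ge_chord04 (Hd erefl).
- exact: sqr_ge4 (Hs erefl).
Qed.

Lemma row_sum_mod4 u :
  (S = 2 * #|[set v | (v \in A) == (u \in A)]|%:Z - 2 %[mod 4])%Z.
Proof.
set B := [set v | _].
have cB v : (c u v = 2 * (v \in B)%:R %[mod 4])%Z.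
  rewrite inE; have [/esym/c_same-> //|] := eqVneq (v \in A) (u \in A).
  by rewrite eq_sym => /c_diff ->.
have : (4 %| \sum_(v | u != v) (c u v - 2 * (v \in B)%:R))%Z.
  by apply: rpred_sum => v _; have := cB v; case: (v \in B) => /= ?; lia.
rewrite sumrB c_row -mulr_sumr sum_neq sum_mem inE eqxx /=.
by lia.
Qed.

End TwoClasses.

(** The classes of 0 and 2 modulo 4 are stable under negation, so for a negative
    row sum the signed bound applies to [- c]. *)
Lemma sum_sqr_ge_chord (I : finType) (c : I -> I -> int) (A : {set I})
    (S : int) :
    (forall u v, c u v = c v u) ->
    (forall u v, (u \in A) = (v \in A) -> (c u v = 2 %[mod 4])%Z) ->
    (forall u v, (u \in A) != (v \in A) -> (c u v = 0 %[mod 4])%Z) ->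
    (forall u, \sum_(v | u != v) c u v = S) ->
  chord_bound #|I|%:R `|S| #|A|%:R <= \sum_u \sum_(v | u != v) c u v ^+ 2.
Proof.
move=> c_sym c_same c_diff c_row.
have [_|_] := ger0P S; first exact: sum_sqr_ge_chord_signed.
under eq_bigr => u _ do under eq_bigr => v _ do rewrite -sqrrN.
apply: sum_sqr_ge_chord_signed => [u v|u v /c_same|u v /c_diff|u].
- by rewrite c_sym.
- by lia.
- by lia.
- by rewrite sumrN c_row.
Qed.

(** * Bounds in terms of the class size *)

Lemma within_boundZ (n p : int) :
  (within_bound n p)%:~R = within_bound n%:~R p%:~R :> rat.
Proof. by rewrite /within_bound !(rmorphB, rmorphM, rmorphXn, rmorphD). Qed.

Lemma chord_boundZ (n d p : int) :
  (chord_bound n d p)%:~R = chord_bound n%:~R d%:~R p%:~R :> rat.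
Proof. by rewrite /chord_bound !(rmorphB, rmorphM, rmorphXn, rmorphD). Qed.

Lemma within_bound_ge (n p : rat) : 2 * n ^+ 2 - 4 * n <= within_bound n p.
Proof. by have := sqr_ge0 (n - 2 * p); rewrite /within_bound; lra. Qed.

Lemma within_bound_ge_unbalanced (n p : rat) : p <= n / 2 - 1 ->
  2 * n ^+ 2 - 4 * n + 8 <= within_bound n p.
Proof.
move=> ?; have : 0 <= (n - 2 * p - 2) * (n - 2 * p + 2) by apply: mulr_ge0; lra.
by rewrite /within_bound; lra.
Qed.

(** A concave quadratic on [[p0, p1]] is minimized at an end; comparing [d] with
    [n - 2 + p0 + p1] tells which, as the difference of the values at [p] and
    [e] is [8 (e - p) (n - 2 - d + p + e)]. *)
Lemma chord_bound_ge_end {n d p0 p1 p : rat} : p0 <= p -> p <= p1 ->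
  (if d <= n - 2 + p0 + p1 then chord_bound n d p1 else chord_bound n d p0)
    <= chord_bound n d p.
Proof.
move=> lep0 lep1; rewrite /chord_bound; case: ifP => [le_d | /negbT].
  have : 0 <= (p1 - p) * (n - 2 - d + p + p1) by apply: mulr_ge0; lra.
  by lra.
rewrite -ltNge => lt_d.
have : 0 <= (p - p0) * (d + 2 - n - p - p0) by apply: mulr_ge0; lra.
by lra.
Qed.

Lemma chord_bound0 (n d : rat) : chord_bound n d 0 = 4 * n ^+ 2 - 4 * n.
Proof. by rewrite /chord_bound; ring. Qed.

Lemma chord_bound1 (n d : rat) :
  chord_bound n d 1 = 4 * n ^+ 2 - 12 * n + 8 * d + 8.
Proof. by rewrite /chord_bound; ring. Qed.

Lemma chord_bound_half (n d : rat) :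
  chord_bound n d (n / 2) = - (2 * n ^+ 2) + 4 * n + 4 * n * d.
Proof. by rewrite /chord_bound; field. Qed.

Lemma chord_bound_half_sub1 (n d : rat) :
  chord_bound n d (n / 2 - 1)
    = - (2 * n ^+ 2) + 20 * n + (4 * n - 8) * d - 24.
Proof. by rewrite /chord_bound; field. Qed.

(** * Rows and columns of a design *)

(** For signs [x, y, z], the number [x y + x z + y z + 1] is 0 or 4. *)
Lemma three_signs_mod4 {I : finType} (x y z : I -> int) :
    (forall i, x i = 1 \/ x i = -1) -> (forall i, y i = 1 \/ y i = -1) ->
    (forall i, z i = 1 \/ z i = -1) ->
  (4 %| \sum_i x i * y i + \sum_i x i * z i + \sum_i y i * z i + #|I|%:Z)%Z.
Proof.
move=> hx hy hz.
have -> : #|I|%:Z = \sum_(i : I) 1 by rewrite -natz -sum1_card natr_sum.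
rewrite -!big_split; apply: rpred_sum => i _ /=.
by case: (hx i) => ->; case: (hy i) => ->; case: (hz i) => ->.
Qed.

(** Both sides are traces, of [X^T X X^T X] and of [X X^T X X^T]. *)
Lemma sum_sqr_gram (R : comPzRingType) (N m : nat) (X : 'M[R]_(N, m)) :
  \sum_i \sum_j (X^T *m X) i j ^+ 2 = \sum_u \sum_v (X *m X^T) u v ^+ 2.
Proof.
have sqr_tr k (B : 'M[R]_k) : B^T = B ->
    \sum_i \sum_j B i j ^+ 2 = \tr (B *m B).
  move=> BT; apply: eq_bigr => i _; rewrite mxE; apply: eq_bigr => j _.
  by rewrite -{3}BT mxE.
rewrite !sqr_tr ?trmx_mul ?trmxK // -mulmxA mxtrace_mulC.
by rewrite !mulmxA.
Qed.

Lemma Es2E (N m : nat) (X : 'M[int]_(N, m)) :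
  Es2 X = (\sum_i \sum_(j | i != j) (X^T *m X) i j ^+ 2)%:~R
            / (m%:R * (m%:R - 1)).
Proof.
rewrite /Es2 sum_neq_sym; last first.
  move=> i j; rewrite !mxE; congr (_ ^+ 2).
  by apply: eq_bigr => k _; rewrite mulrC !mxE.
have -> : \sum_(i < m) \sum_(j < m | (i < j)%N) ((X^T *m X) i j ^+ 2)%:~R
   = (\sum_(i < m) \sum_(j < m | (i < j)%N) ((X^T *m X) i j ^+ 2))%:~R :> rat.
  by rewrite rmorph_sum; apply: eq_bigr => i _; rewrite rmorph_sum.
set Q := (\sum_i _ : int).
have -> : m%:R * (m%:R - 1) = 'C(m, 2)%:R *+ 2 :> rat.
  case: m X @Q => [|m] X Q; first by rewrite mul0r bin0n mul0rn.
  rewrite -natr1 addrK natr1 -mulrnA muln2 -natrM bin2 /=.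
  by congr (_%:R); rewrite even_halfK // oddM /= andNb.
have two_neq0 : 2 != 0 :> rat by rewrite pnatr_eq0.
rewrite rmorphMn /= -[Q%:~R *+ 2]mulr_natr -[_%:R *+ 2]mulr_natr -mulf_div.
by rewrite (divff two_neq0) mulr1.
Qed.

Lemma Es2_ge {N m : nat} {X : 'M[int]_(N, m)} {B : rat} : (0 < m)%N ->
    B <= (\sum_i \sum_(j | i != j) (X^T *m X) i j ^+ 2)%:~R ->
  B / (m%:R * (m%:R - 1)) <= Es2 X.
Proof.
move=> m_gt0 leB; rewrite Es2E; apply: ler_wpM2r => //.
by rewrite invr_ge0 mulr_ge0 ?ler0n // subr_ge0 ler1n.
Qed.

Section Design.
Context {N m : nat} {X : 'M[int]_(N, m)}.
Hypothesis X_design : supersaturated_design X.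

Let T u v := (X *m X^T) u v.

Lemma design_sign u j : X u j = 1 \/ X u j = -1.
Proof. by case: X_design => _ _ /(_ u j). Qed.

Lemma gramE u v : T u v = \sum_j X u j * X v j.
Proof. by rewrite /T mxE; apply: eq_bigr => j _; rewrite mxE. Qed.

Lemma gram_sym u v : T u v = T v u.
Proof. by rewrite !gramE; apply: eq_bigr => j _; rewrite mulrC. Qed.

Lemma gram_diag u : T u u = m%:R.
Proof.
rewrite gramE (eq_bigr (fun _ => 1)) ?sumr_const ?card_ord // => j _.
by case: (design_sign u j) => ->.
Qed.

Lemma design_col_sum j : \sum_u X u j = 0.
Proof.
case: X_design => _ _ _ /(_ j) balanced _.
rewrite (eq_bigr (fun u => (u \in [set r | X r j == 1])%:R
                             - (u \in [set r | X r j == -1])%:R)).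
  by rewrite sumrB !sum_mem balanced subrr.
by move=> u _; rewrite !inE; case: (design_sign u j) => ->.
Qed.

Lemma gram_row_sum u : \sum_v T u v = 0.
Proof.
under eq_bigr => v _ do rewrite gramE.
rewrite exchange_big big1 //= => j _.
by rewrite -mulr_sumr design_col_sum mulr0.
Qed.

Lemma gram_triple u v w : (4 %| T u v + T u w + T v w + m%:Z)%Z.
Proof.
rewrite !gramE -[m in m%:Z]card_ord.
by apply: three_signs_mod4 => j; apply: design_sign.
Qed.

(** The three-signs congruence for two columns and the constant column 1, to
    which balanced columns are orthogonal. *)
Lemma column_product_mod4 i j : (4 %| (X^T *m X) i j + N%:Z)%Z.
Proof.
have sum_mul1 k : \sum_u X u k * 1 = 0.
  by rewrite -[RHS](design_col_sum k); apply: eq_bigr => u _; rewrite mulr1.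
have -> : (X^T *m X) i j = \sum_u X u i * X u j.
  by rewrite mxE; apply: eq_bigr => u _; rewrite mxE.
have := three_signs_mod4 (X^~ i) (X^~ j) (fun=> 1).
rewrite !sum_mul1 !addr0 card_ord.
by apply=> u; [apply: design_sign | apply: design_sign | left].
Qed.

Lemma Es2_ge4 : (1 < m)%N -> (N = 2 %[mod 4])%N -> 4 <= Es2 X.
Proof.
move=> m_gt1 N2.
have m_neq0 : m%:R * (m%:R - 1) != 0 :> rat.
  by rewrite mulf_neq0 // ?subr_eq0 ?pnatr_eq0 ?pnatr_eq1; lia.
rewrite -[X in X <= _](mulfK m_neq0); apply: Es2_ge; first by lia.
have -> : 4 * (m%:R * (m%:R - 1))
    = (\sum_(i < m) \sum_(j < m | i != j) 4)%:~R :> rat.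
  under [in RHS]eq_bigr => i _ do rewrite sum_neq.
  rewrite sumrB !sumr_const !card_ord.
  by rewrite rmorphB !rmorphMn /=; ring.
rewrite ler_int; apply: ler_sum => i _; apply: ler_sum => j _.
by apply: sqr_ge4; have := column_product_mod4 i j; lia.
Qed.

Section Offset.
Context {q : int}.
Hypothesis mq : (m%:Z + q = 2 %[mod 4])%Z.

Let c u v := T u v + q.

Lemma offset_gram_row_sum u :
  \sum_(v | u != v) c u v = - (m%:Z - q * (N%:Z - 1)).
Proof.
rewrite sum_neq big_split /= gram_row_sum sumr_const card_ord /c gram_diag.
by rewrite -mulr_natr !natz; ring.
Qed.

Lemma sum_sqr_columns :
  \sum_i \sum_(j | i != j) (X^T *m X) i j ^+ 2
    = (m%:R + q) ^+ 2 * N%:R - q ^+ 2 * N%:R ^+ 2 - m%:R * N%:R ^+ 2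
      + \sum_u \sum_(v | u != v) c u v ^+ 2.
Proof.
have diag i : (X^T *m X) i i = N%:R.
  rewrite mxE (eq_bigr (fun _ => 1)) ?sumr_const ?card_ord // => u _.
  by rewrite mxE; case: (design_sign u i) => ->.
under eq_bigr => i _ do rewrite sum_neq diag.
rewrite sumrB sum_sqr_gram sumr_const card_ord.
have -> : \sum_u \sum_(v | u != v) c u v ^+ 2
    = \sum_(u < N) (\sum_v T u v ^+ 2 + q ^+ 2 * N%:R - (m%:R + q) ^+ 2).
  apply: eq_bigr => u _; rewrite sum_neq /c gram_diag; congr (_ - _).
  under eq_bigr => v _ do rewrite sqrrD.
  rewrite !big_split /= sumr_const card_ord -!mulr_suml.
  by rewrite gram_row_sum mul0r !addr0 mulr_natr.
rewrite sumrB big_split /= !sumr_const !card_ord.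
by ring.
Qed.

(** The two classes are the rows [v] with [T u0 v = m mod 4] and the others, for
    a fixed row [u0]; [p] is the size of the smaller one.  The congruence for
    [p] comes from counting modulo 4 in the row [u0], which works with the class
    of [u0] even if the smaller class is empty. *)
Lemma exists_class_size (u0 : 'I_N) :
  exists p : nat,
    [/\ (2 * p <= N)%N,
        (m%:Z - q * (N%:Z - 1) = 2 * p%:Z - 2 %[mod 4])%Z,
        within_bound N%:R p%:R <= \sum_u \sum_(v | u != v) c u v ^+ 2
      & chord_bound N%:R `|m%:Z - q * (N%:Z - 1)| p%:R
          <= \sum_u \sum_(v | u != v) c u v ^+ 2].
Proof.
have N_even : ~~ odd N by case: X_design.
have c_sym u v : c u v = c v u by rewrite /c gram_sym.
pose A0 := [set v | (4 %| T u0 v - m%:Z)%Z].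
have c_same0 u v : (u \in A0) = (v \in A0) -> (c u v = 2 %[mod 4])%Z.
  have := gram_triple u0 u v.
  have := gram_triple u0 u u; have := gram_triple u0 v v.
  by rewrite !inE !gram_diag natz /c; lia.
have c_diff0 u v : (u \in A0) != (v \in A0) -> (c u v = 0 %[mod 4])%Z.
  have := gram_triple u0 u v.
  (* A repeated row shows that the entries have the parity of m, so that
     not being m modulo 4 means being m + 2. *)
  have := gram_triple u0 u u; have := gram_triple u0 v v.
  by rewrite !inE !gram_diag natz /c; lia.
have [A same_or_compl A_small] :
    exists2 A, A = A0 \/ A = ~: A0 & (2 * #|A| <= N)%N.
  have := cardsC A0; rewrite card_ord => cA.
  have [?|?] := leqP (2 * #|A0|)%N N; first by exists A0; [left |].
  by exists (~: A0); [right | lia].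
have c_same u v : (u \in A) = (v \in A) -> (c u v = 2 %[mod 4])%Z.
  case: same_or_compl => ->; first exact: c_same0.
  by rewrite !in_setC => /negb_inj/c_same0.
have c_diff u v : (u \in A) != (v \in A) -> (c u v = 0 %[mod 4])%Z.
  by case: same_or_compl => ->; rewrite ?in_setC ?(inj_eq negb_inj) => /c_diff0.
exists #|A|; split => //.
- have := @row_sum_mod4 _ _ _ _ c_same c_diff offset_gram_row_sum u0.
  have := cardsC A; rewrite card_ord.
  have -> : [set v | (v \in A) == (u0 \in A)] = if u0 \in A then A else ~: A.
    by apply/setP => v; case: ifP => _; rewrite !inE ?eqb_id ?eqbF_neg.
  by case: ifP => _; lia.
- by have := @sum_sqr_ge_within _ _ _ c_same; rewrite card_ord.
- have := @sum_sqr_ge_chord _ _ _ _ c_sym c_same c_diff offset_gram_row_sum.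
  by rewrite card_ord normrN.
Qed.

End Offset.
End Design.

(** * The offset q *)

(** The condition confines [q] to a half-open interval of length 4, as [q] is
    multiplied by [N - 1] and the interval for [m - q (N - 1)] has length
    [4 (N - 1)]; such an interval meets each class modulo 4 exactly once. *)
Lemma admissible_exists_unique (N m : nat) :
  (1 < N)%N -> exists! q, admissible N m q.
Proof.
move=> N_gt1.
pose M : int := N%:Z - 1; have M_gt0 : 0 < M by rewrite /M; lia.
(* The largest q with m - q M > - 2 M. *)
pose b := ((m%:Z + 2 * M - 1) %/ M)%Z.
have b_eq := divz_eq (m%:Z + 2 * M - 1) M; rewrite -/b in b_eq.
have r_lt := ltz_pmod (m%:Z + 2 * M - 1) M_gt0.
have r_ge := modz_ge0 (m%:Z + 2 * M - 1) (lt0r_neq0 M_gt0).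
pose e := ((b + m%:Z - 2) %% 4)%Z.
have e_ge : 0 <= e by rewrite /e; lia.
have e_le : e <= 3 by rewrite /e; lia.
have eM_ge : 0 <= e * M by apply: mulr_ge0; lia.
have eM_le : e * M <= 3 * M by apply: ler_wpM2r; lia.
exists (b - e); split; last first.
  move=> q [q_lo q_hi q_mod]; rewrite -/M in q_lo q_hi.
  have [|[]] : b - e = q \/ 4 <= q - (b - e) \/ 4 <= (b - e) - q.
  - by rewrite /e; lia.
  - by [].
  - by move=> far; have : 0 <= (q - (b - e) - 4) * M by [apply: mulr_ge0; lia]; lia.
  - by move=> far; have : 0 <= (b - e - q - 4) * M by [apply: mulr_ge0; lia]; lia.
split; rewrite -/M; [lia | lia |].
by rewrite /e; lia.
Qed.

(** * The lower bounds *)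

Theorem theorem3p1 (N m : nat) (N_gt0 : (0 < N)%N) (N_even : ~~ odd N)
    (m_gt0 : (0 < m)%N) (m_gt : (N - 1 < m)%N) :
  (exists! q : int, admissible N m q) /\
  (forall q : int, admissible N m q ->
   forall X : 'M[int]_(N, m), supersaturated_design X ->
   [/\ (N = 0 %[mod 4])%N -> bound_0mod4 N m q <= Es2 X,
       (N = 2 %[mod 4])%N -> (2 %| q)%Z -> Num.max (h_even N m q) 4 <= Es2 X
     & (N = 2 %[mod 4])%N -> ~~ (2 %| q)%Z ->
         Num.max (h_odd N m q) 4 <= Es2 X]).
Proof.
split; first by apply: admissible_exists_unique; lia.
move=> q [_ _ mq] X X_design.
have [p [p_le p_mod within chord]] :=
  exists_class_size X_design mq (Ordinal N_gt0).
set Q := \sum_u _ in within chord.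
have sumE := @sum_sqr_columns _ _ _ X_design q; rewrite -/Q in sumE.
have bound_le B E : B <= Q%:~R -> E = g N m q + B ->
    E / (m%:R * (m%:R - 1)) <= Es2 X.
  move=> leB ->; apply: Es2_ge => //; rewrite sumE rmorphD lerD //.
  by rewrite /g !(rmorphB, rmorphM, rmorphXn, rmorphD) /= !rmorph_nat.
have devE : dev N m q = `|m%:Z - q * (N%:Z - 1)|%:~R.
  by rewrite intr_norm !(rmorphB, rmorphM).
have {}within : within_bound N%:R p%:R <= Q%:~R :> rat.
  by move: within; rewrite -(ler_int rat) within_boundZ !rmorph_nat.
have {}chord : chord_bound N%:R (dev N m q) p%:R <= Q%:~R.
  by move: chord; rewrite -(ler_int rat) chord_boundZ !rmorph_nat devE.
have p_le_half : p%:R <= N%:R / 2 :> rat.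
  by rewrite ler_pdivlMr // -natrM ler_nat mulnC.
have p_ge0 : 0 <= p%:R :> rat by [].
split=> [N0|N2 q_even|N2 q_odd].
- have {}within := le_trans (within_bound_ge _ _) within.
  have {}chord := le_trans (chord_bound_ge_end p_ge0 p_le_half) chord.
  rewrite chord_bound0 chord_bound_half in chord.
  rewrite /bound_0mod4; case: ifP => _; first by apply: (bound_le _ _ within); ring.
  have -> : 3 / 2 * N%:R - 2 = N%:R - 2 + 0 + N%:R / 2 :> rat by field.
  by case: ifP chord => _ chord; apply: (bound_le _ _ chord); ring.
- (* Here p is even and N / 2 is odd. *)
  have p_le_half1 : p%:R <= N%:R / 2 - 1 :> rat.
    by rewrite lerBrDr ler_pdivlMr // natr1 -natrM ler_nat; lia.
  rewrite ge_max Es2_ge4 ?andbT //; last by lia.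
  have {}within := le_trans (within_bound_ge_unbalanced _ _ p_le_half1) within.
  have {}chord := le_trans (chord_bound_ge_end p_ge0 p_le_half1) chord.
  rewrite chord_bound0 chord_bound_half_sub1 in chord.
  rewrite /h_even; case: ifP => _; first by apply: (bound_le _ _ within); ring.
  have -> : 3 / 2 * N%:R - 3 = N%:R - 2 + 0 + (N%:R / 2 - 1) :> rat by field.
  by case: ifP chord => _ chord; apply: (bound_le _ _ chord); ring.
- (* Here p is odd. *)
  have p_ge1 : 1 <= p%:R :> rat by rewrite ler1n; lia.
  rewrite ge_max Es2_ge4 ?andbT //; last by lia.
  have {}within := le_trans (within_bound_ge _ _) within.
  have {}chord := le_trans (chord_bound_ge_end p_ge1 p_le_half) chord.
  rewrite chord_bound1 chord_bound_half in chord.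
  rewrite /h_odd; case: ifP => _; first by apply: (bound_le _ _ within); ring.
  have -> : 3 / 2 * N%:R - 1 = N%:R - 2 + 1 + N%:R / 2 :> rat by field.
  by case: ifP chord => _ chord; apply: (bound_le _ _ chord); ring.
Qed.
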